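(* Let $X_1,\dots,X_n$ be independent $\{0,1\}$-valued random variables, let $\mathcal{T}$ be a compact set of vectors $t=(t_I)_{I\in\mathcal{I}_{n,d}}$ in $\mathbb{R}^{\binom nd}$ with nonnegative coordinates, and let $$Z=\sup_{t\in\mathcal{T}}\sum_{I\in\mathcal{I}_{n,d}}\Bigl(\prod_{i\in I}X_i\Bigr)t_I .$$ For $k=0,1,\dots,d-1$ let $$M_k=\max_{J\in\mathcal{I}_{n,d-k}}\ \sup_{t\in\mathcal{T}}\ \sum_{I\in\mathcal{I}_{n,d}:\,J\subseteq I}\Bigl(\prod_{j\in I\setminus J}X_j\Bigr)t_I .$$ Then for all real $q\ge2$, $$\|(Z-\mathbb{E}[Z])_+\|_q\le2\sum_{j=1}^d\left\{(\kappa q)^{j/2}\sqrt{\frac{d!}{(d-j)!}}\,\sqrt{\mathbb{E}[Z]\,\mathbb{E}[M_{d-j}]}+(\kappa q)^j\,\frac{d!}{(d-j)!}\,\mathbb{E}[M_{d-j}]\right\} .$$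
   Context: $1\le d<n$; for $0\le m\le n$, $\mathcal{I}_{n,m}$ denotes the family of subsets of $\{1,\dots,n\}$ of size $m$; $\mathcal{T}$ is nonempty. Empty products equal $1$. $x_+=\max(x,0)$, $\|Y\|_q=(\mathbb{E}|Y|^q)^{1/q}$, $\kappa=\frac{\sqrt e}{2(\sqrt e-1)}<1.271$. *)

(* Defs.v *)
From HB Require Import structures.
From mathcomp Require Import all_boot all_order all_algebra.
From mathcomp Require Import all_classical all_reals all_analysis.

Set Implicit Arguments.
Unset Strict Implicit.
Unset Printing Implicit Defensive.

Import Order.TTheory GRing.Theory Num.Theory.
Import numFieldNormedType.Exports.

Local Open Scope classical_set_scope.
Local Open Scope ring_scope.

Definition mutually_independent {disp : measure_display}
    {T : measurableType disp} {R : realType} (P : probability T R) {n : nat}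
    (X : 'I_n -> {RV P >-> R}) : Prop :=
  forall (K : {set 'I_n}) (B : 'I_n -> set R),
    (forall i, measurable (B i)) ->
    P (\bigcap_(i in [set` K]) X i @^-1` B i) =
    (\prod_(i in K) P (X i @^-1` B i))%E.

(* The index set {1, ..., n} is represented by 'I_n = {0, ..., n - 1}. *)
Definition ksubset (n m : nat) := {I : {set 'I_n} | #|I| == m}.

(* As the index type is finite, the topology of pointwise convergence is the
   usual topology of the Euclidean space R^('C(n, d)). *)
Definition chaos_coef (R : realType) (n d : nat) := {ptws ksubset n d -> R}.

Section chaos.
Context {Omega : Type} {R : realType} {n d : nat}.
Variables (X : 'I_n -> Omega -> R) (TT : set (chaos_coef R n d)).

(* The suprema are over bounded nonempty sets, hence genuine, as soon as TT is
   nonempty and compact. *)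
Definition chaos_sup (w : Omega) : R :=
  sup [set \sum_(I : ksubset n d) (\prod_(i in val I) X i w) * t I | t in TT].

(* The unit 0 of the iterated maximum does not affect its value: J ranges over
   a nonempty type if d <= n, and the suprema are nonnegative for nonnegative
   X and coefficients. *)
Definition chaos_max (k : nat) (w : Omega) : R :=
  \big[Num.max/0]_(J : ksubset n (d - k))
    sup [set \sum_(I : ksubset n d | val J \subset val I)
               (\prod_(j in val I :\: val J) X j w) * t I | t in TT].

End chaos.

Definition kappa (R : realType) : R :=
  Num.sqrt (expR 1) / (2 * (Num.sqrt (expR 1) - 1)).

(* Main.v *)
Require Import Defs.
From HB Require Import structures.
From mathcomp Require Import all_boot all_order all_algebra.
From mathcomp Require Import all_classical all_reals all_analysis.
From mathcomp Require Import measurable_realfun.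
From mathcomp Require Import ring lra.

Set Implicit Arguments.
Unset Strict Implicit.
Unset Printing Implicit Defensive.

Import Order.TTheory GRing.Theory Num.Theory.
Import numFieldNormedType.Exports.

Local Open Scope classical_set_scope.
Local Open Scope ring_scope.

(** Only the random set S = {i | X_i = 1} matters.  Its law is a product
    measure on the subsets of {1, ..., n}, and Z = M_d and all the M_k are
    nondecreasing functions of S; write Z_i for the value of Z at S minus i.

    The analytic core is a moment inequality for such functions
    ([positive_part_moment]): if V is the sum of the (Z - Z_i)^2, then
    ||(Z - E Z)_+||_q^2 <= kappa q ||V||_(q/2).  With Y = (Z - E Z)_+, it is
    obtained by climbing from q - 1 to q through
      E Y^q <= (E Y^(q-1))^(q/(q-1)) + (q/2) E (V Y^(q-2))   ([moment_step]),
    starting at q <= 2 from the Efron-Stein inequality; kappa is the constant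
    for which the climb closes up ([kappa_recursion]).  The step itself is
    the tensorization of the defect E f^p - (E f)^p for f = Y^(q-1) and
    p = q/(q-1), which lies in (1, 2] ([entropy_tensorization]): that defect
    is at most the sum over i of the mean Bregman divergences, for the power
    p, between f(S) and f(S minus i).  Tensorization rests on the joint
    convexity of this divergence ([bregman_convex2]), and a direct estimate
    bounds each divergence by (q/2) (Y - Y_i)^2 Y^(q-2)
    ([bregman_powR_le]).

    The combinatorial input is that the M_k bound one another: deleting i
    from S lowers M_(k+1) by at most M_k ([max_link_diff]), and all these
    decreases add up to at most k M_k for M_k ([max_link_sum]), because the
    monomials in M_k have degree k.  Hence V <= k M_(k-1) M_k for M_k, and the
    moment inequality becomes a quadratic inequality whose solution
    ([self_bounding_moment]) is
      ||M_k||_q <= 2 E M_k + kappa q k ||M_(k-1)||_q,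
      ||(M_d - E M_d)_+||_q <= sqrt (C E M_d) + C,
      where C = kappa q d ||M_(d-1)||_q.
    Since M_0 does not depend on S, unfolding the first line down to M_0 and
    inserting the result into the second gives the theorem, the square root
    being subadditive. *)

(** * Power inequalities on the line *)

Section real_inequalities.
Context {R : realType}.
Implicit Types a b m r s t x y A B : R.

Lemma le_of_derive_ge0 (f df : R -> R) a b : a <= b ->
  (forall x, a <= x <= b -> is_derive x 1 f (df x)) ->
  (forall x, a <= x <= b -> 0 <= df x) -> f a <= f b.
Proof.
move=> ab fdf df0.
have fx x : x \in `]a, b[ -> is_derive x 1 f (df x).
  by rewrite in_itv/= => /andP[ax xb]; apply: fdf; rewrite !ltW.
have [|c] := MVT_segment ab fx.
  apply: continuous_in_subspaceT => x; rewrite inE/= in_itv/= => xab.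
  apply: differentiable_continuous; apply/derivable1_diffP.
  by have [] := fdf _ xab.
rewrite in_itv/= => cab fab.
by rewrite -subr_ge0 fab mulr_ge0 ?subr_ge0// df0.
Qed.

Lemma powR_convex2 m t x y : 1 <= m -> 0 <= t <= 1 -> 0 <= x -> 0 <= y ->
  (t * x + (1 - t) * y) `^ m <= t * x `^ m + (1 - t) * y `^ m.
Proof.
move=> m1 /andP[t0 t1] x0 y0.
have := @convex_powR R m m1 (Itv01 t0 t1) x y.
by rewrite !inE /= !in_itv /= !andbT => /(_ x0 y0); rewrite !convRE.
Qed.

(** Young's inequality for the conjugate exponents 1 + r and 1 + 1/r.  For
    fixed s it says that x^(1 + r) lies above its tangent at x = s^(1/r), which
    is how it is used below. *)
Lemma powR_young r s x : 0 < r -> 0 <= s -> 0 <= x ->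
  (1 + r) * (s * x) <= x `^ (1 + r) + r * s `^ (1 + r^-1).
Proof.
move=> r0 s0 x0; have r1 : 0 < 1 + r by rewrite addr_gt0.
have q0 : 0 < 1 + r^-1 by rewrite addr_gt0 ?invr_gt0.
have qE : 1 + r^-1 = (1 + r) / r by field; rewrite gt_eqF.
have /(ler_wpM2l (ltW r1)) : s * x <= s `^ (1 + r^-1) / (1 + r^-1)
   + x `^ (1 + r) / (1 + r).
  apply: conjugate_powR => //; rewrite qE; field.
  by rewrite !gt_eqF.
suff -> : forall u v,
  (1 + r) * (u / (1 + r^-1) + v / (1 + r)) = v + r * u by [].
by move=> u v; rewrite qE; field; rewrite !gt_eqF.
Qed.

(** What remains of the tangent plane inequality for the Bregman divergence
    ([bregman_support] below) once its first variable has been minimized out.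
    The two sides agree at A = 1, and the derivative in A of their difference
    has a sign by convexity of the power m, since A + B - 1 is A times the
    barycenter of B and 1 with weights 1/A and 1 - 1/A. *)
Lemma powR_add_sub1_le m A B : 1 <= m -> 1 <= A -> 0 <= B ->
  (A + B - 1) `^ (1 + m) <= A `^ (1 + m) + B `^ (1 + m) + m^-1
    - (1 + m^-1) * (A `^ m + B `^ m - A `^ m * B `^ m).
Proof.
move=> m1 A1 B0; have m0 : 0 < m by rewrite (lt_le_trans ltr01).
pose f A := A `^ (1 + m) - (1 + m^-1) * (1 - B `^ m) * A `^ m
  - (A + (B - 1)) `^ (1 + m).
pose df A := (1 + m) * (A `^ m - (1 - B `^ m) * A `^ (m - 1)
  - (A + (B - 1)) `^ m).
have fdf x : 0 < x -> 0 < x + (B - 1) -> is_derive x 1 f (df x).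
  move=> x0 y0.
  rewrite /f.
  have d1 : is_derive x 1 (fun x => (x + (B - 1)) `^ (1 + m))
      ((1 + m) * (x + (B - 1)) `^ m).
    have d2 := is_derive1_powR (1 + m) y0.
    have d3 : is_derive x 1 (fun x => x + (B - 1)) 1.
      by apply: is_derive_eq; rewrite addr0.
    have := @is_derive1_comp _ (fun z => z `^ (1 + m))
      (fun x => x + (B - 1)) _ _ _ d2 d3.
    by rewrite mulr1 [1 + m]addrC addrK.
  have d4 := is_derive1_powR (1 + m) x0.
  have d5 := is_derive1_powR m x0.
  apply: is_derive_eq; rewrite /df /GRing.scale/=.
  by rewrite [1 + m - 1]addrAC subrr add0r; field; rewrite gt_eqF.
have df0 x : 1 <= x -> 0 <= df x.
  move=> x1; have x0 : 0 < x by rewrite (lt_le_trans ltr01).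
  rewrite /df mulr_ge0 //; first by lra.
  rewrite subr_ge0.
  have i1 : x^-1 <= 1 by rewrite invf_le1.
  have i0 : 0 <= x^-1 by rewrite invr_ge0 ltW.
  have -> : x + (B - 1) = x * (x^-1 * B + (1 - x^-1) * 1).
    by field; rewrite gt_eqF.
  rewrite powRM ?(ltW x0)//; last by rewrite addr_ge0// mulr_ge0// subr_ge0.
  apply: le_trans (ler_wpM2l (powR_ge0 _ _)
    (powR_convex2 m1 _ B0 ler01)) _; first by rewrite i0 i1.
  rewrite powR1 -(mulr_powRB1 (ltW x0) m0) le_eqVlt; apply/orP; left.
  by apply/eqP; field; rewrite gt_eqF.
suff f1 : - (B `^ (1 + m) + m^-1 - (1 + m^-1) * B `^ m) <= f A.
  move: f1; rewrite /f addrA; lra.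
have mon a : 1 <= a -> 0 < a + (B - 1) -> a <= A -> f a <= f A.
  move=> a1 aB aA; apply: (@le_of_derive_ge0 f df) => // x /andP[ax xA].
    apply: fdf; first by lra.
    by lra.
  by apply: df0; lra.
move: B0; rewrite le_eqVlt => /predU1P[B0|B0].
  (* For B = 0 the power of A + B - 1 is not differentiable at A = 1, so the
     comparison starts at 1 + e, where the loss is at most e. *)
  rewrite -B0 !powR0 ?gt_eqF ?addr_gt0//.
  suff H e : 0 < e -> e < 1 -> e < A - 1 ->
      - (0 + m^-1 - (1 + m^-1) * 0) <= f A + e.
    move: A1; rewrite le_eqVlt => /predU1P[<-|A1].
      rewrite /f -B0 !powR1 (_ : 1 + (0 - 1) = 0); last by ring.
      by rewrite !powR0 ?gt_eqF ?addr_gt0//; lra.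
    apply/ler_addgt0Pr => e e0.
    pose e' := Num.min (e / 2) (Num.min (1 / 2) ((A - 1) / 2)).
    have : e' <= e by rewrite /e' ge_min; apply/orP; left; lra.
    have e'0 : 0 < e' by rewrite /e' !lt_min; apply/and3P; split; lra.
    have : e' < 1 by rewrite /e' !gt_min; apply/or3P; apply: Or32; lra.
    have : e' < A - 1 by rewrite /e' !gt_min; apply/or3P; apply: Or33; lra.
    by move=> h1 h2 h3; have := H _ e'0 h2 h1; lra.
  move=> e0 e1 eA; have : f (1 + e) <= f A by apply: mon; lra.
  suff : - m^-1 - e <= f (1 + e) by lra.
  rewrite /f -B0 powR0 ?gt_eqF//.
  have -> : 1 + e + (0 - 1) = e by ring.
  have e2 : e `^ (1 + m) <= e by apply: ge1r_powR; lra.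
  have im0 : 0 < m^-1 by rewrite invr_gt0.
  have := powR_young im0 ler01 (powR_ge0 (1 + e) m).
  rewrite -powRrM powR1 mul1r mulr1.
  have -> : m * (1 + m^-1) = 1 + m by field; rewrite gt_eqF.
  by rewrite subr0 mulr1; lra.
have b1 : 0 < 1 + (B - 1) by lra.
have := mon 1 (lexx _) b1 A1.
rewrite /f !powR1 (_ : 1 + (B - 1) = B); last by ring.
lra.
Qed.

End real_inequalities.

(** * The Bregman divergence of a power *)

Section bregman.
Context {R : realType}.
Implicit Types a b c r s t x y q w : R.

(** The gap at x between the power 1 + r and its tangent at y, namely
    phi(x) - phi(y) - phi'(y) (x - y) for phi(x) = x^(1 + r). *)
Definition bregman r x y : R :=
  x `^ (1 + r) + r * y `^ (1 + r) - (1 + r) * (y `^ r * x).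

Lemma bregmanZ r c x y : 0 < r -> 0 <= c -> 0 <= x -> 0 <= y ->
  bregman r (c * x) (c * y) = c `^ (1 + r) * bregman r x y.
Proof.
move=> r0 c0 x0 y0; have r1 : 0 < 1 + r by rewrite addr_gt0.
rewrite /bregman !powRM// -(mulr_powRB1 c0 r1) [1 + r - 1]addrAC subrr add0r.
ring.
Qed.

Lemma bregman_ge0 r x y : 0 < r -> 0 <= x -> 0 <= y -> 0 <= bregman r x y.
Proof.
move=> r0 x0 y0.
have := powR_young r0 (powR_ge0 y r) x0.
rewrite -powRrM (_ : r * (1 + r^-1) = 1 + r); last by field; rewrite gt_eqF.
by rewrite /bregman; lra.
Qed.

(** The divergence lies above its tangent plane at (a, 1).  Euler's identity
    for functions homogeneous of degree 1 + r turns the value and the gradient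
    at (a, 1) into this form.  For fixed y the minimum over x is attained where
    x^r = a^r + y^r - 1; Young's inequality at that point leaves
    [powR_add_sub1_le] with A = a^r and B = y^r. *)
Lemma bregman_support r a x y : 0 < r <= 1 -> 1 <= a -> 0 <= x -> 0 <= y ->
  (1 + r) * ((a `^ r - 1) * x + r * (1 - a) * y) <=
  bregman r x y + r * bregman r a 1.
Proof.
move=> /andP[r0 r1] a1 x0 y0; have m1 : 1 <= r^-1 by rewrite invf_ge1.
have rn0 : r != 0 by rewrite gt_eqF.
have a0 : 0 <= a by rewrite (le_trans ler01).
have A1 : 1 <= a `^ r by rewrite -(powRr0 a) ler_powR// ltW.
have B0 : 0 <= y `^ r by exact: powR_ge0.
have := powR_add_sub1_le m1 A1 B0.
rewrite -!powRrM invrK (_ : r * (1 + r^-1) = 1 + r); last by field.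
rewrite divff// !powRr1//.
have s0 : 0 <= a `^ r + y `^ r - 1 by lra.
have := powR_young r0 s0 x0.
rewrite /bregman !powR1 => h1 /(ler_wpM2l (ltW r0)) h2.
nra.
Qed.

(** Joint convexity in the region y <= x, the only one needed since the
    divergences below compare a function with a smaller one: by homogeneity the
    barycenter of the second coordinates can be scaled to 1, and then the
    tangent planes of [bregman_support] are averaged. *)
Lemma bregman_convex2 r t x0 x1 y0 y1 : 0 < r <= 1 -> 0 <= t <= 1 ->
  0 <= y0 <= x0 -> 0 <= y1 <= x1 ->
  bregman r (t * x0 + (1 - t) * x1) (t * y0 + (1 - t) * y1) <=
  t * bregman r x0 y0 + (1 - t) * bregman r x1 y1.
Proof.
move=> r01 /andP[t0 t1] /andP[y00 yx0] /andP[y10 yx1].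
have /andP[r0 r1] := r01.
have t10 : 0 <= 1 - t by rewrite subr_ge0.
have x00 := le_trans y00 yx0; have x10 := le_trans y10 yx1.
set a := t * x0 + _; set b := t * y0 + _.
have b0 : 0 <= b by rewrite addr_ge0// mulr_ge0.
have ba : b <= a by rewrite lerD// ler_wpM2l.
move: b0; rewrite le_eqVlt => /predU1P[b0|b0].
  (* Scaling is impossible if b = 0, but then every point of nonzero weight
     has y = 0, where the divergence is the convex power 1 + r. *)
  have h : a `^ (1 + r) <= t * x0 `^ (1 + r) + (1 - t) * x1 `^ (1 + r).
    by apply: powR_convex2 => //; [lra | rewrite t0].
  rewrite -b0.
  have D0 s x y : s * y = 0 -> s * bregman r x y = s * x `^ (1 + r).
    move=> /eqP; rewrite mulf_eq0 => /orP[|] /eqP ->; first by rewrite !mul0r.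
    rewrite /bregman !powR0 ?gt_eqF ?addr_gt0//.
    by rewrite mulr0 mul0r mulr0 subr0 addr0.
  have := @D0 1 a 0; rewrite mulr0 !mul1r => -> //.
  rewrite !D0 //.
    move: b0; rewrite /b => /esym/eqP.
    by rewrite paddr_eq0 ?mulr_ge0// => /andP[_ /eqP].
  move: b0; rewrite /b => /esym/eqP.
  by rewrite paddr_eq0 ?mulr_ge0// => /andP[/eqP].
have bn0 : b != 0 by rewrite gt_eqF.
have bS z : z = b * (z / b) by rewrite mulrC divfK.
have ab1 : 1 <= a / b by rewrite ler_pdivlMr// mul1r.
have sc x y : 0 <= x -> 0 <= y ->
    bregman r x y = b `^ (1 + r) * bregman r (x / b) (y / b).
  move=> x0' y0'; rewrite [in LHS](bS x) [in LHS](bS y).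
  by rewrite bregmanZ ?divr_ge0// ltW.
rewrite (sc a b) ?(ltW b0)// ?(le_trans (ltW b0))// (sc x0)// (sc x1)//.
rewrite !(mulrCA _ (b `^ _)) -mulrDr ler_wpM2l ?powR_ge0//.
have := bregman_support r01 ab1 (divr_ge0 x00 (ltW b0)) (divr_ge0 y00 (ltW b0)).
have := bregman_support r01 ab1 (divr_ge0 x10 (ltW b0)) (divr_ge0 y10 (ltW b0)).
move=> /(ler_wpM2l t10) h1 /(ler_wpM2l t0) h0.
have := lerD h0 h1; rewrite divff//.
have r1' : 0 < 1 + r by rewrite addr_gt0.
have ab0 : 0 <= a / b by rewrite (le_trans ler01).
have e1 : t * (x0 / b) + (1 - t) * (x1 / b) = a / b.
  by rewrite !mulrA -mulrDl.
have e2 : t * (y0 / b) + (1 - t) * (y1 / b) = 1.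
  by rewrite !mulrA -mulrDl -/b divff.
set D0 := bregman r (x0 / b) _; set D1 := bregman r (x1 / b) _.
have D : bregman r (a / b) 1
    = (a / b) * (a / b) `^ r + r - (1 + r) * (a / b).
  by rewrite /bregman !powR1 -(mulr_powRB1 ab0 r1') [1 + r - 1]addrAC subrr
       add0r mulr1 mul1r.
have lin u v : t * ((1 + r) * (u * (x0 / b) + v * (y0 / b))) +
    (1 - t) * ((1 + r) * (u * (x1 / b) + v * (y1 / b))) =
    (1 + r) * (u * (a / b) + v).
  transitivity ((1 + r) * (u * (t * (x0 / b) + (1 - t) * (x1 / b)) +
      v * (t * (y0 / b) + (1 - t) * (y1 / b)))); first by ring.
  by rewrite e1 e2 mulr1.
rewrite lin.
rewrite D; lra.
Qed.

(** Both sides vanish at w = y.  The derivative in w of the right side minus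
    the left side is, up to the factor - q / (q - 1), the amount by which the
    power q - 1 at w exceeds its tangent at y. *)
Lemma bregman_powR_le q y w : 2 <= q -> 0 <= w <= y ->
  bregman (q - 1)^-1 (y `^ (q - 1)) (w `^ (q - 1)) <=
  q / 2 * ((y - w) ^+ 2 * y `^ (q - 2)).
Proof.
move=> q2 /andP[w0 wy]; have y0 := le_trans w0 wy.
have qn0 : q - 1 != 0 by rewrite gt_eqF//; lra.
have q0 : 0 < q by lra.
have E1 : (q - 1) * (1 + (q - 1)^-1) = q by field.
rewrite /bregman -!powRrM E1 divff// powRr1//.
have q20 : 0 <= q - 2 by lra.
have q1p : 0 < q - 1 by lra.
move: w0; rewrite le_eqVlt => /predU1P[<-|w0].
  rewrite powR0 ?gt_eqF// mulr0 mul0r mulr0 subr0 addr0 subr0.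
  have -> : y ^+ 2 * y `^ (q - 2) = y `^ q.
    rewrite -(mulr_powRB1 y0 q0) -(mulr_powRB1 y0 q1p) mulrA -expr2.
    by congr (_ * _ `^ _); ring.
  have := powR_ge0 y q; nra.
have {}y0 : 0 < y by rewrite (lt_le_trans w0).
pose g x := - (q / 2 * ((y - x) ^+ 2 * y `^ (q - 2)) -
  (y `^ q + (q - 1)^-1 * x `^ q - (1 + (q - 1)^-1) * (x * y `^ (q - 1)))).
pose dg x := - (- q * (y - x) * y `^ (q - 2) - 
  ((q - 1)^-1 * (q * x `^ (q - 1)) - (1 + (q - 1)^-1) * y `^ (q - 1))).
have gdg x : 0 < x -> is_derive x 1 g (dg x).
  move=> x0; rewrite /g.
  have d1 := is_derive1_powR q x0.
  apply: is_derive_eq; rewrite /dg /GRing.scale/=.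
  by lra.
suff : g w <= g y.
  rewrite /g subrr expr0n/= mul0r mulr0.
  rewrite -(mulr_powRB1 (ltW y0) q0).
  set z := y * _; have : z + (q - 1)^-1 * z - (1 + (q - 1)^-1) * z = 0 by ring.
  lra.
apply: (@le_of_derive_ge0 R g dg w y wy) => x /andP[wx xy].
  by apply: gdg; lra.
rewrite /dg.
have x0 : 0 <= x by lra.
have tangent : (q - 1) * (y `^ (q - 2) * x) <=
    x `^ (q - 1) + (q - 2) * y `^ (q - 1).
  have [->|qn2] := eqVneq q 2.
    rewrite subrr powRr0 (_ : 2 - 1 = 1); last by ring.
    by rewrite !powRr1// ?(ltW y0)//; lra.
  have r0 : 0 < q - 2 by rewrite lt_def subr_eq0 qn2.
  have := powR_young r0 (powR_ge0 y (q - 2)) x0.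
  rewrite -powRrM (_ : (q - 2) * (1 + (q - 2)^-1) = q - 1); 
    last by field; rewrite gt_eqF.
  by rewrite (_ : 1 + (q - 2) = q - 1)//; ring.
have yE : y * y `^ (q - 2) = y `^ (q - 1).
  by rewrite -(mulr_powRB1 (ltW y0) q1p); congr (_ * _ `^ _); ring.
move: tangent; rewrite -yE => tangent.
have k0 : 0 <= (q - 1)^-1 * q by rewrite mulr_ge0 ?invr_ge0; lra.
have := ler_wpM2l k0 tangent.
rewrite -subr_ge0; congr (0 <= _).
by field.
Qed.

End bregman.

(** * Tensorization on a product of two-point spaces *)

Section product_space.
Context {R : realType} {I : finType}.
Variable p : I -> R.
Hypothesis p01 : forall i, 0 <= p i <= 1.
Implicit Types (F G : {set I} -> R) (S T : {set I}) (i : I) (s : seq I) (r : R).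

(** A point of the product space is the set S of coordinates equal to 1, and
    i belongs to S with probability p i.  Averaging over coordinate i is kept as
    an operator on functions of S, so that conditional expectations are
    iterated averages and no change of space is needed in inductions. *)
Definition avg i F S : R := (1 - p i) * F (S :\ i) + p i * F (i |: S).

Definition avgs s F : {set I} -> R := foldr avg F s.

Lemma avg_le i F G S : (forall T, F T <= G T) -> avg i F S <= avg i G S.
Proof.
by move=> FG; have /andP[? ?] := p01 i; rewrite lerD// ler_wpM2l// subr_ge0.
Qed.

Lemma avgs_le s F G S : (forall T, F T <= G T) -> avgs s F S <= avgs s G S.
Proof. by move=> FG; elim: s S => //= i s IH S; exact: avg_le. Qed.

Lemma avgs_cst s (c : R) S : avgs s (fun=> c) S = c.
Proof.
elim: s S => //= i s IH S.
by rewrite /avg !IH -mulrDl subrK mul1r.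
Qed.

Lemma avgs_ge0 s F S : (forall T, 0 <= F T) -> 0 <= avgs s F S.
Proof. by move=> F0; rewrite -[leLHS](avgs_cst s 0 S); exact: avgs_le. Qed.

Lemma bregman_avgs r s F G S : 0 < r <= 1 -> (forall T, 0 <= G T <= F T) ->
  bregman r (avgs s F S) (avgs s G S) <=
  avgs s (fun T => bregman r (F T) (G T)) S.
Proof.
move=> r01 GF; elim: s S => [|i s IH] S //=.
apply: le_trans (avg_le i S IH).
have /andP[p0 p1] := p01 i.
have pE : p i = 1 - (1 - p i) by rewrite opprB addrCA subrr addr0.
have GF' T : 0 <= avgs s G T <= avgs s F T.
  rewrite avgs_ge0 ?avgs_le// => U; first by have /andP[] := GF U.
  by have /andP[] := GF U.
rewrite /avg [X in _ + X * _]pE [X in bregman _ _ (_ + X * _)]pE.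
rewrite [X in _ <= _ + X * _]pE.
by apply: bregman_convex2 => //; apply/andP; split; lra.
Qed.

Lemma avgs_setD1 s F i S :
  avgs s (fun T => F (T :\ i)) (S :\ i) = avgs s (fun T => F (T :\ i)) (i |: S).
Proof.
suff H : forall T U, T :\ i = U :\ i ->
    avgs s (fun T => F (T :\ i)) T = avgs s (fun T => F (T :\ i)) U.
  apply: H; apply/setP => j; rewrite !inE.
  by case: (j == i).
elim: s => [|j s IH] T U TU /=; first by rewrite TU.
rewrite /avg; congr (_ * _ + _ * _); apply: IH; move/setP: TU => TU;
  apply/setP => k; have := TU k; rewrite !inE; do 2 case: eqP => //=.
Qed.

(** Peel off one coordinate at a time.  Write g for the average of f = F over
    the other coordinates: the defect of f splits into the average of the
    inner defects and the defect of g in coordinate i.  The latter is at most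
    the mean divergence between g and any v constant along coordinate i; the
    average of f(S minus i) over the other coordinates is such a v, and
    Jensen's inequality for the divergence undoes that average. *)
Lemma avgs_entropy_le r s F S : 0 < r <= 1 ->
  (forall T, 0 <= F T) -> (forall i T, F (T :\ i) <= F T) ->
  avgs s (fun T => F T `^ (1 + r)) S <= avgs s F S `^ (1 + r) +
  \sum_(i <- s) avgs s (fun T => bregman r (F T) (F (T :\ i))) S.
Proof.
move=> r01 F0 Fle; have /andP[r0 r1] := r01.
elim: s S => [|i s IH] S /=; first by rewrite big_nil addr0.
apply: le_trans (avg_le i S IH) _.
rewrite big_cons addrA.
pose H i := avgs s (fun T => bregman r (F T) (F (T :\ i))).
have /= -> : avg i (fun T => avgs s F T `^ (1 + r) + \sum_(j <- s) H j T) S =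
    avg i (fun T => avgs s F T `^ (1 + r)) S + \sum_(j <- s) avg i (H j) S.
  by rewrite /avg !mulrDr !mulr_sumr big_split/=; ring.
apply: lerD; last by [].
pose v := avgs s (fun T => F (T :\ i)).
have step T : bregman r (avgs s F T) (v T) <= H i T.
  by apply: bregman_avgs => // U; rewrite F0 Fle.
apply: le_trans (lerD (lexx _) (avg_le i S step)).
rewrite /avg -(avgs_setD1 s F i S : v (S :\ i) = v (i |: S)).
set g0 := avgs s F (S :\ i); set g1 := avgs s F (i |: S).
have v0 : 0 <= v (S :\ i) by exact: avgs_ge0.
have g00 : 0 <= g0 by exact: avgs_ge0.
have g10 : 0 <= g1 by exact: avgs_ge0.
have /andP[p0 p1] := p01 i.
have m0 : 0 <= (1 - p i) * g0 + p i * g1.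
  by rewrite addr_ge0// mulr_ge0// subr_ge0.
(* Replacing v by the average of g would only decrease the divergence. *)
have := bregman_ge0 r0 m0 v0.
rewrite /bregman; lra.
Qed.

Definition weight S : R := \prod_i (if i \in S then p i else 1 - p i).

Definition mean F : R := \sum_S weight S * F S.

Lemma weight_ge0 S : 0 <= weight S.
Proof.
apply: prodr_ge0 => i _; have /andP[? ?] := p01 i.
by case: ifP; rewrite ?subr_ge0.
Qed.

Lemma sum_weight : \sum_S weight S = 1.
Proof.
have -> : 1 = \prod_i (p i + (1 - p i)).
  by rewrite big1// => i _; rewrite addrC subrK.
by rewrite bigA_distr.
Qed.

(** Pair each set avoiding i with the set obtained by adding i: their weights
    are in the ratio 1 - p i to p i. *)
Lemma mean_avg i F : mean (avg i F) = mean F.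
Proof.
have split_i G :
    \sum_S G S = \sum_(S : {set I} | i \notin S) (G (i |: S) + G S).
  rewrite big_split/= (bigID (fun S : {set I} => i \in S))/=; congr (_ + _).
  rewrite (reindex_onto (fun S => i |: S) (fun S => S :\ i)) /=; last first.
    by move=> S; exact: finset.setD1K.
  apply: eq_bigl => S; rewrite finset.setU11/=; apply/eqP/idP => [<-|iS].
    by rewrite !inE eqxx.
  by rewrite finset.setU1K.
rewrite /mean !split_i; apply: eq_bigr => S iS.
have Si : S :\ i = S.
  by apply/setP => j; rewrite !inE; case: eqP => // ->; rewrite (negbTE iS).
have SSi : i |: (i |: S) = i |: S by rewrite finset.setUA finset.setUid.
rewrite /avg finset.setU1K// Si SSi.
have wE T : weight T = (if i \in T then p i else 1 - p i) *
    \prod_(j | j != i) (if j \in T then p j else 1 - p j).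
  by rewrite /weight (bigD1 i).
have rest : \prod_(j | j != i) (if j \in i |: S then p j else 1 - p j) =
    \prod_(j | j != i) (if j \in S then p j else 1 - p j).
  by apply: eq_bigr => j ji; rewrite !inE (negbTE ji).
rewrite !wE rest finset.setU11 (negbTE iS).
ring.
Qed.

Lemma mean_avgs s F : mean (avgs s F) = mean F.
Proof. by elim: s => //= i s <-; exact: mean_avg. Qed.

Lemma avgs_mean F S : avgs (enum I) F S = mean F.
Proof.
have H s T (U : {set I}) : (forall i, i \notin s -> (i \in T) = (i \in U)) ->
    avgs s F T = avgs s F U.
  elim: s T U => [|i s IH] T U TU /=.
    by congr F; apply/setP => j; exact: TU.
  rewrite /avg; congr (_ * _ + _ * _); apply: IH => j js; rewrite !inE;
    have := TU j; rewrite inE negb_or js andbT; by case: eqP => //= _ ->.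
rewrite -(mean_avgs (enum I)) /mean.
rewrite (eq_bigr (fun T => weight T * avgs (enum I) F S)); last first.
  by move=> T _; congr (_ * _); apply: H => i; rewrite mem_enum.
by rewrite -mulr_suml sum_weight mul1r.
Qed.

Lemma entropy_tensorization r F : 0 < r <= 1 ->
  (forall S, 0 <= F S) -> (forall i S, F (S :\ i) <= F S) ->
  mean (fun S => F S `^ (1 + r)) <= mean F `^ (1 + r) +
  \sum_i mean (fun S => bregman r (F S) (F (S :\ i))).
Proof.
move=> r01 F0 Fle; have := avgs_entropy_le (enum I) finset.set0 r01 F0 Fle.
rewrite !avgs_mean big_enum /=.
by under eq_bigr do rewrite avgs_mean.
Qed.

End product_space.

(** * Means and power means *)

Section mean_theory.
Context {R : realType} {I : finType}.
Variable p : I -> R.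
Hypothesis p01 : forall i, 0 <= p i <= 1.
Implicit Types (F G : {set I} -> R) (S : {set I}) (c q s t : R).

Lemma mean_le F G : (forall S, F S <= G S) -> mean p F <= mean p G.
Proof. by move=> FG; apply: ler_sum => S _; rewrite ler_wpM2l ?weight_ge0. Qed.

Lemma mean_cst c : mean p (fun=> c) = c.
Proof. by rewrite /mean -mulr_suml sum_weight mul1r. Qed.

Lemma mean_ge0 F : (forall S, 0 <= F S) -> 0 <= mean p F.
Proof. by move=> F0; rewrite -(mean_cst 0); exact: mean_le. Qed.

Lemma meanD F G : mean p (fun S => F S + G S) = mean p F + mean p G.
Proof. by rewrite /mean -big_split; apply: eq_bigr => S _; rewrite mulrDr. Qed.

Lemma meanZ c F : mean p (fun S => c * F S) = c * mean p F.
Proof. by rewrite /mean mulr_sumr; apply: eq_bigr => S _; rewrite mulrCA. Qed.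

Lemma mean_sum (J : finType) (F : J -> {set I} -> R) :
  mean p (fun S => \sum_j F j S) = \sum_j mean p (F j).
Proof.
rewrite /mean exchange_big; apply: eq_bigr => S _.
by rewrite mulr_sumr.
Qed.

Lemma eq_mean F G : F =1 G -> mean p F = mean p G.
Proof. by move=> FG; apply: eq_bigr => S _; rewrite FG. Qed.

Lemma mean_eq0 F G : (forall S, 0 <= F S) -> mean p F = 0 ->
  (forall S, F S = 0 -> G S = 0) -> mean p G = 0.
Proof.
move=> F0 /eqP; rewrite psumr_eq0; last first.
  by move=> S _; rewrite mulr_ge0 ?weight_ge0.
move=> /allP FS FG; apply: big1 => S _.
have := FS S (mem_index_enum _); rewrite mulf_eq0 => /orP[|]/eqP.
  by move=> ->; rewrite mul0r.
by move=> /FG ->; rewrite mulr0.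
Qed.

(** Hoelder's inequality in the form that yields every inequality between
    power means used below, by choosing powers for F and G. *)
Lemma mean_hoelder t F G : 0 < t < 1 ->
  (forall S, 0 <= F S) -> (forall S, 0 <= G S) ->
  mean p (fun S => F S `^ t * G S `^ (1 - t)) <=
  mean p F `^ t * mean p G `^ (1 - t).
Proof.
move=> /andP[t0 t1] F0 G0; have t1' : 0 < 1 - t by rewrite subr_gt0.
have mF0 := mean_ge0 F0; have mG0 := mean_ge0 G0.
move: mF0; rewrite le_eqVlt => /predU1P[mF0|mF0].
  rewrite (mean_eq0 F0 (esym mF0)) ?mulr_ge0 ?powR_ge0// => S ->.
  by rewrite powR0 ?gt_eqF// mul0r.
move: mG0; rewrite le_eqVlt => /predU1P[mG0|mG0].
  rewrite (mean_eq0 G0 (esym mG0)) ?mulr_ge0 ?powR_ge0// => S ->.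
  by rewrite (powR0 (x := 1 - t)) ?gt_eqF// mulr0.
set a := mean p F in mF0 *; set b := mean p G in mG0 *.
have nF : a != 0 by rewrite gt_eqF.
have nG : b != 0 by rewrite gt_eqF.
pose c := a `^ t * b `^ (1 - t).
apply: (@le_trans _ _
  (mean p (fun S => c * (t / a * F S + (1 - t) / b * G S)))).
  apply: mean_le => S.
  have f0 : 0 <= F S / a by rewrite divr_ge0// ltW.
  have g0 : 0 <= G S / b by rewrite divr_ge0// ltW.
  have := @conjugate_powR R ((F S / a) `^ t) ((G S / b) `^ (1 - t))
    t^-1 (1 - t)^-1 (powR_ge0 _ _) (powR_ge0 _ _).
  rewrite !invr_gt0 !invrK -!powRrM !divff ?gt_eqF// !powRr1// => /(_ t0 t1').
  have tt : t + (1 - t) = 1 by ring.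
  move=> /(_ tt) h.
  have -> : F S `^ t * G S `^ (1 - t) =
      c * ((F S / a) `^ t * (G S / b) `^ (1 - t)).
    rewrite /c mulrACA -!powRM ?(ltW mF0) ?(ltW mG0)//.
    by rewrite !(mulrC _ (_ / _)) !divfK.
  rewrite ler_wpM2l ?mulr_ge0 ?powR_ge0//.
  by rewrite (le_trans h)// le_eqVlt; apply/orP; left; apply/eqP; ring.
rewrite meanZ meanD !meanZ -/a -/b !divfK// -/c.
by rewrite [t + _]addrC subrK mulr1.
Qed.

Lemma mean_powR_le s t F : 0 < s <= t -> (forall S, 0 <= F S) ->
  mean p (fun S => F S `^ s) <= mean p (fun S => F S `^ t) `^ (s / t).
Proof.
move=> /andP[s0 st] F0; have t0 := lt_le_trans s0 st.
have [->|nst] := eqVneq s t.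
  by rewrite divff ?gt_eqF// powRr1// mean_ge0// => S; exact: powR_ge0.
have st1 : 0 < s / t < 1.
  by rewrite divr_gt0//= ltr_pdivrMr// mul1r lt_neqAle nst.
have := @mean_hoelder (s / t) (fun S => F S `^ t) (fun=> 1) st1
  (fun S => powR_ge0 _ _) (fun=> ler01).
rewrite mean_cst powR1 mulr1; apply: le_trans; apply: mean_le => S.
by rewrite mulr1 -powRrM mulrC divfK// gt_eqF.
Qed.

Definition pnorm q F : R := mean p (fun S => F S `^ q) `^ q^-1.

Lemma pnorm_ge0 q F : 0 <= pnorm q F. Proof. exact: powR_ge0. Qed.

Lemma powR_pnorm q s F : (forall S, 0 <= F S) -> 0 < q ->
  pnorm q F `^ s = mean p (fun S => F S `^ q) `^ (s / q).
Proof. by move=> F0 q0; rewrite -powRrM mulrC. Qed.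

Lemma pnormK q F : (forall S, 0 <= F S) -> 0 < q ->
  pnorm q F `^ q = mean p (fun S => F S `^ q).
Proof.
move=> F0 q0; rewrite powR_pnorm// divff ?gt_eqF// powRr1//.
by apply: mean_ge0 => S; exact: powR_ge0.
Qed.

Lemma pnorm_le q F G : 0 < q -> (forall S, 0 <= F S) ->
  (forall S, F S <= G S) -> pnorm q F <= pnorm q G.
Proof.
move=> q0 F0 FG; apply: ge0_ler_powR.
- by rewrite invr_ge0 ltW.
- by rewrite nnegrE mean_ge0// => S; exact: powR_ge0.
- by rewrite nnegrE mean_ge0// => S; exact: powR_ge0.
apply: mean_le => S; apply: ge0_ler_powR; rewrite ?nnegrE ?(ltW q0)//.
exact: le_trans (F0 S) (FG S).
Qed.

Lemma pnorm_homo s t F : 0 < s <= t -> (forall S, 0 <= F S) ->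
  pnorm s F <= pnorm t F.
Proof.
move=> /andP[s0 st] F0; have t0 := lt_le_trans s0 st.
rewrite /pnorm; have -> : t^-1 = (s / t) * s^-1.
  by field; rewrite !gt_eqF.
rewrite powRrM; apply: ge0_ler_powR.
- by rewrite invr_ge0 ltW.
- by rewrite nnegrE mean_ge0// => S; exact: powR_ge0.
- by rewrite nnegrE powR_ge0.
by apply: mean_powR_le; rewrite ?s0.
Qed.

Lemma pnorm_cst q c : 0 < q -> 0 <= c -> pnorm q (fun=> c) = c.
Proof.
by move=> q0 c0; rewrite /pnorm mean_cst -powRrM divff ?gt_eqF// powRr1.
Qed.

Lemma mean_mul_le q s F G : 0 < s < q ->
  (forall S, 0 <= F S) -> (forall S, 0 <= G S) ->
  mean p (fun S => F S * G S `^ (q - s)) <=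
  pnorm (q / s) F * pnorm q G `^ (q - s).
Proof.
move=> /andP[s0 sq] F0 G0; have q0 := lt_trans s0 sq.
have sq1 : 0 < s / q < 1 by rewrite divr_gt0//= ltr_pdivrMr// mul1r.
have := @mean_hoelder _ (fun S => F S `^ (q / s)) (fun S => G S `^ q) sq1
  (fun S => powR_ge0 _ _) (fun S => powR_ge0 _ _).
have sn : s != 0 by rewrite gt_eqF.
have qn : q != 0 by rewrite gt_eqF.
rewrite powR_pnorm// /pnorm invf_div mulrBl divff//.
apply: le_trans; apply: mean_le => S.
rewrite -!powRrM (_ : q / s * (s / q) = 1); last by field; rewrite sn qn.
by rewrite powRr1// (_ : q * (1 - s / q) = q - s)//; field.
Qed.

(** Minkowski's inequality when one term is constant: expand the power q of
    U = c + F as c U^(q-1) + F U^(q-1) and apply Hoelder's inequality to each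
    term. *)
Lemma pnorm_add_cst q c F : 1 < q -> 0 <= c -> (forall S, 0 <= F S) ->
  pnorm q (fun S => c + F S) <= c + pnorm q F.
Proof.
move=> q1 c0 F0; have q0 : 0 < q by rewrite (lt_trans ltr01).
pose U S := c + F S.
have U0 S : 0 <= U S by rewrite addr_ge0.
have q1' : (0 : R) < 1 < q by rewrite ltr01.
rewrite -/U.
have [->|UN] := eqVneq (pnorm q U) 0; first by rewrite addr_ge0 ?pnorm_ge0.
have Up : 0 < pnorm q U by rewrite lt_def UN pnorm_ge0.
rewrite -(ler_pM2r (powR_gt0 (q - 1) Up)).
rewrite mulr_powRB1 ?pnorm_ge0// pnormK//.
rewrite (eq_mean (G := fun S =>
  c * U S `^ (q - 1) + F S * U S `^ (q - 1))); last first.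
  by move=> S; rewrite -mulrDl -/(U S) mulr_powRB1.
have := mean_mul_le q1' F0 U0.
have := @mean_mul_le q 1 (fun=> c) U q1' (fun=> c0) U0.
rewrite divr1 pnorm_cst// meanD mulrDl => h1 h2.
exact: lerD.
Qed.

Lemma pnorm_mul_le q F G : 0 < q ->
  (forall S, 0 <= F S) -> (forall S, 0 <= G S) ->
  pnorm (q / 2) (fun S => F S * G S) <= pnorm q F * pnorm q G.
Proof.
move=> q0 F0 G0; have q20 : 0 < q / 2 by rewrite divr_gt0.
have h12 : 0 < (2^-1 : R) < 1 by lra.
have := @mean_hoelder _ (fun S => F S `^ q) (fun S => G S `^ q) h12
  (fun S => powR_ge0 _ _) (fun S => powR_ge0 _ _).
rewrite (_ : 1 - 2^-1 = 2^-1 :> R); last by lra.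
rewrite (eq_mean (G := fun S => (F S * G S) `^ (q / 2))); last first.
  by move=> S; rewrite -!powRrM powRM.
move=> h; rewrite /pnorm.
have -> : q^-1 = 2^-1 * (q / 2)^-1 by field; rewrite gt_eqF.
rewrite !powRrM -powRM ?powR_ge0//.
apply: ge0_ler_powR => //; rewrite ?nnegrE ?mulr_ge0 ?powR_ge0//.
  by rewrite invr_ge0 ltW.
by rewrite mean_ge0// => S; exact: powR_ge0.
Qed.

Lemma pnormZ q c F : 0 < q -> 0 <= c -> (forall S, 0 <= F S) ->
  pnorm q (fun S => c * F S) = c * pnorm q F.
Proof.
move=> q0 c0 F0; rewrite /pnorm (eq_mean (G := fun S => c `^ q * F S `^ q)).
  rewrite meanZ powRM ?powR_ge0//; last first.
    by rewrite mean_ge0// => S; exact: powR_ge0.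
  by rewrite -powRrM divff ?gt_eqF// powRr1.
by move=> S; rewrite powRM.
Qed.

End mean_theory.

(** * The moment inequality *)

Section kappa_constant.
Context {R : realType}.
Implicit Types q v M N : R.

Let E : R := expR (1 / 2).

Let kappaE : kappa R = E / (2 * (E - 1)).
Proof.
rewrite /kappa; have -> : Num.sqrt (expR 1) = E; last by [].
have -> : expR 1 = E ^+ 2 :> R by rewrite /E expr2 -expRD; congr expR; lra.
by rewrite sqrtr_sqr ger0_norm// expR_ge0.
Qed.

Let E1 : 1 < E. Proof. by rewrite expR_gt1; lra. Qed.

Let E0 : 0 < E. Proof. exact: expR_gt0. Qed.

Lemma kappa_ge1 : 1 <= kappa R.
Proof.
have E2 : E <= 2.
  have := expR_ge1Dx (- (1 / 2) : R); rewrite expRN -/E.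
  rewrite -(ler_pM2r E0) mulVf ?gt_eqF//; lra.
have h := E1; rewrite kappaE ler_pdivlMr ?mul1r; lra.
Qed.

Lemma half_inv_kappa : (2 * kappa R)^-1 = 1 - expR (- (1 / 2)).
Proof.
rewrite expRN -/E kappaE; have := E1 => h; field.
by rewrite !gt_eqF// subr_gt0.
Qed.

(** The role of the constant kappa.  If N^2 exceeded kappa q v, then the first
    term would be at most (1 - 1/q)^(q/2) N^q <= exp(-1/2) N^q and the second
    one less than N^q / (2 kappa) = (1 - exp(-1/2)) N^q, contradicting the
    hypothesis. *)
Lemma kappa_recursion q v M N : 2 <= q -> 0 <= v -> 0 <= M -> 0 <= N ->
  M ^+ 2 <= kappa R * (q - 1) * v ->
  N `^ q <= M `^ q + q / 2 * (v * N `^ (q - 2)) ->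
  N ^+ 2 <= kappa R * q * v.
Proof.
move=> q2 v0 M0 N0 Mv Nle; have k1 := kappa_ge1.
have k0 : 0 < kappa R by rewrite (lt_le_trans ltr01).
have q0 : 0 < q by lra.
have qn : q != 0 by rewrite gt_eqF.
rewrite leNgt; apply/negP => vN.
have Np : 0 < N.
  rewrite lt_def N0 andbT; apply/eqP => N00; move: vN.
  by rewrite N00 expr0n/= ltNge mulr_ge0// mulr_ge0// ltW.
have MN : M `^ q <= expR (- (1 / 2)) * N `^ q.
  rewrite -[X in expR X](divfK qn).
  rewrite expRM -powRM ?expR_ge0//.
  apply: ge0_ler_powR; rewrite ?nnegrE ?(ltW q0) ?mulr_ge0 ?expR_ge0//.
  rewrite -(ler_pXn2r (ltn0Sn 1)) ?nnegrE ?mulr_ge0 ?expR_ge0//.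
  rewrite exprMn [expR _ ^+ 2]expr2 -expRD.
  have -> : - (1 / 2) / q + - (1 / 2) / q = - q^-1 by field.
  apply: le_trans Mv _.
  have h := expR_ge1Dx (- q^-1).
  apply: le_trans (ler_wpM2r (exprn_ge0 2 N0) h).
  have -> : kappa R * (q - 1) * v = (1 + - q^-1) * (kappa R * q * v) by field.
  rewrite ler_wpM2l ?(ltW vN)// subr_ge0 invf_le1//; lra.
have NE : N `^ q = N ^+ 2 * N `^ (q - 2).
  rewrite -[N ^+ 2](powR_mulrn 2 N0) -powRD; first by congr (_ `^ _); ring.
  by rewrite (gt_eqF Np) implybT.
have vlt : q / 2 * (v * N `^ (q - 2)) < (2 * kappa R)^-1 * N `^ q.
  rewrite NE (mulrA (q / 2)) (mulrA (2 * kappa R)^-1) ltr_pM2r ?powR_gt0//.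
  have -> : q / 2 * v = (2 * kappa R)^-1 * (kappa R * q * v).
    by field; rewrite gt_eqF.
  by rewrite ltr_pM2l// invr_gt0 mulr_gt0.
move: vlt; rewrite half_inv_kappa => vlt.
have := lt_le_trans (ltr_leD vlt MN) (lexx _).
rewrite -mulrDl subrK mul1r => h.
by move: Nle; rewrite leNgt addrC h.
Qed.

End kappa_constant.

Section moment_inequality.
Context {R : realType} {I : finType}.
Variable p : I -> R.
Hypothesis p01 : forall i, 0 <= p i <= 1.
Variable Z : {set I} -> R.
Hypothesis Z_ge0 : forall S, 0 <= Z S.
Hypothesis Z_mono : forall i S, Z (S :\ i) <= Z S.
Implicit Types (S : {set I}) (q : R).

Let V S : R := \sum_i (Z S - Z (S :\ i)) ^+ 2.

Let Y S : R := Num.max (Z S - mean p Z) 0.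

Let V_ge0 S : 0 <= V S.
Proof. by apply: sumr_ge0 => i _; exact: sqr_ge0. Qed.

Let Y_ge0 S : 0 <= Y S. Proof. by rewrite le_max lexx orbT. Qed.

Let Y_mono i S : Y (S :\ i) <= Y S.
Proof. by rewrite /Y ge_max !le_max lerD2r Z_mono lexx orbT. Qed.

Let Y_diff i S : Y S - Y (S :\ i) <= Z S - Z (S :\ i).
Proof.
have := Z_mono i S; rewrite /Y.
by case: (leP (Z S - _)); case: (leP (Z (S :\ i) - _)); lra.
Qed.

(** Tensorization for the power 2, whose divergence is the squared
    difference. *)
Lemma efron_stein : mean p (fun S => (Z S - mean p Z) ^+ 2) <= mean p V.
Proof.
have r01 : (0 : R) < (1 : R) <= (1 : R) by rewrite ltr01 lexx.
have := entropy_tensorization p01 r01 Z_ge0 Z_mono.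
have sq x : 0 <= x -> x `^ (1 + 1) = x ^+ 2 :> R.
  by move=> x0; rewrite -(powR_mulrn 2 x0); congr (_ `^ _); ring.
rewrite (sq _ (mean_ge0 p01 Z_ge0)) -mean_sum.
rewrite (eq_mean _ (G := fun S => Z S ^+ 2)); last by move=> S; rewrite sq.
rewrite [X in _ + X](_ : _ = mean p V); last first.
  apply: eq_mean => S; apply: eq_bigr => i _.
  by rewrite /bregman !sq// powRr1//; ring.
rewrite -lerBlDl; apply: le_trans; rewrite le_eqVlt; apply/orP; left; apply/eqP.
rewrite (eq_mean _ (G := fun S => Z S ^+ 2 +
  ((- (2 * mean p Z)) * Z S + mean p Z ^+ 2))); last by move=> S; ring.
by rewrite !meanD meanZ mean_cst//; ring.
Qed.

(** Tensorization for the power q / (q - 1) of Y^(q-1), in which every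
    divergence is at most (q/2) (Y - Y_i)^2 Y^(q-2) and Y - Y_i is at most
    Z - Z_i. *)
Lemma moment_step q : 2 < q ->
  pnorm p q Y `^ q <=
  pnorm p (q - 1) Y `^ q + q / 2 * mean p (fun S => V S * Y S `^ (q - 2)).
Proof.
move=> q2; have q0 : 0 < q by lra.
have q1 : 0 < q - 1 by lra.
have q1n : q - 1 != 0 by rewrite gt_eqF.
have r01 : 0 < (q - 1)^-1 <= 1 by rewrite invr_gt0 q1 invf_le1//; lra.
have rE : 1 + (q - 1)^-1 = q / (q - 1) by field.
have Fmono i S : Y (S :\ i) `^ (q - 1) <= Y S `^ (q - 1).
  by apply: ge0_ler_powR; rewrite ?nnegrE ?(ltW q1).
have := entropy_tensorization p01 r01 (fun S => powR_ge0 (Y S) (q - 1)) Fmono.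
rewrite rE => h.
rewrite [leLHS](pnormK p01 Y_ge0 q0) [X in _ <= X + _](powR_pnorm p q Y_ge0 q1).
apply: le_trans (le_trans _ h) _.
  apply: mean_le => // S; rewrite -powRrM (_ : (q - 1) * _ = q) //; by field.
rewrite lerD2l -meanZ -mean_sum; apply: mean_le => // S.
rewrite mulr_suml mulr_sumr; apply: ler_sum => i _.
have yy : 0 <= Y (S :\ i) <= Y S by rewrite Y_ge0 Y_mono.
apply: le_trans (bregman_powR_le (ltW q2) yy) _.
rewrite ler_wpM2l ?divr_ge0 ?(ltW q0)// ler_wpM2r ?powR_ge0//.
by rewrite ler_pXn2r ?nnegrE ?subr_ge0 ?Y_mono.
Qed.

(** All exponents between 1 and q are treated with the same bound v for V,
    the norm of V with exponent q/2 being the largest one that occurs, so that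
    unit steps connect any exponent to the range up to 2. *)
Lemma positive_part_moment q : 2 <= q ->
  pnorm p q Y ^+ 2 <= kappa R * q * pnorm p (q / 2) V.
Proof.
move=> q2.
have q1 : (0 : R) < (1 : R) <= q / 2 by apply/andP; split; lra.
have Vq s : 0 < s <= q / 2 -> pnorm p s V <= pnorm p (q / 2) V.
  by move=> sq; exact: (pnorm_homo p01 sq V_ge0).
have := pnorm_ge0 p (q / 2) V; move: Vq.
move: (pnorm p (q / 2) V) => v Vq v0.
have k1 := @kappa_ge1 R.
have base s : 1 <= s <= 2 -> pnorm p s Y ^+ 2 <= kappa R * s * v.
  move=> /andP[s1 s2].
  have s02 : 0 < s <= 2 by rewrite s2 andbT; lra.
  apply: le_trans (lerXn2r 2 (pnorm_ge0 _ _ _) (pnorm_ge0 _ _ _)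
    (pnorm_homo p01 s02 Y_ge0)) _.
  rewrite -(powR_mulrn 2 (pnorm_ge0 _ _ _)) (pnormK p01 Y_ge0 (ltr0Sn R 1)).
  apply: (@le_trans _ _ (mean p V)).
    apply: le_trans efron_stein; apply: mean_le => // S.
    rewrite powR_mulrn// /Y; case: (leP (Z S - mean p Z) 0) => // _.
    by rewrite expr0n sqr_ge0.
  apply: (@le_trans _ _ v).
    have <- : pnorm p 1 V = mean p V.
      rewrite /pnorm invr1 powRr1; last first.
        by apply: mean_ge0 => // S; exact: powR_ge0.
      by apply: eq_mean => S; rewrite powRr1.
    exact: Vq.
  have ks : 1 <= kappa R * s by exact: mulr_ege1.
  by rewrite ler_peMl.
have rec k : forall s, 1 <= s -> s <= q -> s <= k%:R + 2 ->
    pnorm p s Y ^+ 2 <= kappa R * s * v.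
  elim: k => [|k IH] s s1 sq sk.
    by apply: base; rewrite s1; move: sk; rewrite add0r.
  have [s2|s2] := leP s 2; first by apply: base; rewrite s1.
  apply: (@kappa_recursion _ s v (pnorm p (s - 1) Y)) => //.
  - exact: ltW.
  - exact: pnorm_ge0.
  - exact: pnorm_ge0.
  - apply: IH; [lra|lra|]. move: sk; rewrite -natr1; lra.
  apply: le_trans (moment_step s2) _.
  rewrite lerD2l ler_wpM2l//; first by lra.
  have s02 : (0 : R) < 2 < s by rewrite s2 andbT.
  apply: le_trans (mean_mul_le p01 s02 V_ge0 Y_ge0) _.
  rewrite ler_wpM2r ?powR_ge0//.
  have sq2 : 0 < s / 2 <= q / 2 by apply/andP; split; lra.
  exact: Vq.
apply: (rec (Num.truncn q).+1) => //; first by lra.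
have := truncnS_gt q; lra.
Qed.

End moment_inequality.

(** * Self-bounding functions and their iteration *)

Section self_bounding.
Context {R : realType} {I : finType}.
Variable p : I -> R.
Hypothesis p01 : forall i, 0 <= p i <= 1.
Implicit Types (S : {set I}) (q a b c x z : R) (Z W : {set I} -> R).

Lemma self_bounding_solve a c x z : 0 <= a -> 0 <= c -> 0 <= x ->
  z <= a + x -> x ^+ 2 <= c * z ->
  z <= 2 * a + c /\ x <= Num.sqrt (c * a) + c.
Proof.
move=> a0 c0 x0 zax xcz.
have xac : x ^+ 2 <= c * (a + x) by apply: le_trans xcz _; rewrite ler_wpM2l.
have ca0 : 0 <= c * a by rewrite mulr_ge0.
split.
  suff : x <= a + c by lra.
  by rewrite leNgt; apply/negP => h; nra.
have s0 := sqrtr_ge0 (c * a); have s2 := sqr_sqrtr ca0.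
set s := Num.sqrt _ in s0 s2 *.
rewrite leNgt; apply/negP => h.
have h1 : s * s <= x * (x - c) by apply: ler_pM => //; lra.
have h2 : 0 < (x - c - s) * x by apply: mulr_gt0; lra.
by nra.
Qed.

(** Here V <= b W Z pointwise, so the moment inequality gives x^2 <= c z for
    x = ||(Z - E Z)_+||_q and z = ||Z||_q; moreover z <= E Z + x. *)
Lemma self_bounding_moment q b Z W : 2 <= q -> 0 <= b ->
  (forall S, 0 <= W S) -> (forall S, 0 <= Z S) ->
  (forall i S, Z (S :\ i) <= Z S) ->
  (forall i S, Z S - Z (S :\ i) <= W S) ->
  (forall S, \sum_i (Z S - Z (S :\ i)) <= b * Z S) ->
  let c := kappa R * q * b * pnorm p q W in
  pnorm p q Z <= 2 * mean p Z + c /\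
  pnorm p q (fun S => Num.max (Z S - mean p Z) 0) <=
    Num.sqrt (c * mean p Z) + c.
Proof.
move=> q2 b0 W0 Z0 Zmono ZW Zsum c; have q0 : 0 < q by lra.
have k0 : 0 <= kappa R by rewrite (le_trans ler01)// kappa_ge1.
have q20 : 0 < q / 2 by lra.
have V0 S : 0 <= \sum_i (Z S - Z (S :\ i)) ^+ 2.
  by apply: sumr_ge0 => i _; exact: sqr_ge0.
have VW S : \sum_i (Z S - Z (S :\ i)) ^+ 2 <= b * (W S * Z S).
  rewrite mulrCA; apply: le_trans (ler_wpM2l (W0 S) (Zsum S)).
  rewrite mulr_sumr; apply: ler_sum => i _; rewrite expr2.
  by rewrite ler_wpM2r ?subr_ge0.
apply: self_bounding_solve.
- exact: mean_ge0.
- by rewrite /c mulr_ge0 ?pnorm_ge0// mulr_ge0// mulr_ge0// ltW.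
- exact: pnorm_ge0.
- apply: le_trans (pnorm_add_cst p01 _ (mean_ge0 p01 Z0) _).
  + apply: pnorm_le => // S.
    by rewrite -lerBlDl le_max lexx.
  + lra.
  + by move=> S; rewrite le_max lexx orbT.
apply: le_trans (positive_part_moment p01 Z0 Zmono q2) _.
have step : pnorm p (q / 2) (fun S => \sum_i (Z S - Z (S :\ i)) ^+ 2) <=
    b * (pnorm p q W * pnorm p q Z).
  apply: le_trans (pnorm_le p01 q20 V0 VW) _.
  rewrite pnormZ//; last by move=> S; rewrite mulr_ge0.
  by rewrite ler_wpM2l// pnorm_mul_le.
have kq0 : 0 <= kappa R * q by rewrite mulr_ge0// ltW.
apply: le_trans (ler_wpM2l kq0 step) _.
by rewrite /c (mulrA (kappa R * q) b) (mulrA _ (pnorm p q W)) lexx.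
Qed.

End self_bounding.

(** The function M k stands for the maximal partial chaos of degree k, and M d
    for Z itself; only their mutual bounds enter. *)
Section iterated_bound.
Context {R : realType} {I : finType}.
Variable p : I -> R.
Hypothesis p01 : forall i, 0 <= p i <= 1.
Variables (d : nat) (M : nat -> {set I} -> R).
Hypothesis M_ge0 : forall k S, 0 <= M k S.
Hypothesis M_mono : forall k i S, M k (S :\ i) <= M k S.
Hypothesis M_0 : forall S T, M 0 S = M 0 T.
Hypothesis M_diff : forall k i S, (k < d)%N ->
  M k.+1 S - M k.+1 (S :\ i) <= M k S.
Hypothesis M_sum : forall k S, (k <= d)%N ->
  \sum_i (M k S - M k (S :\ i)) <= k%:R * M k S.
Variable q : R.
Hypothesis q_ge2 : 2 <= q.

Variable c : R.
Hypothesis cE : c = kappa R * q.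

Let c0 : 0 <= c.
Proof.
have := @kappa_ge1 R; have := q_ge2; rewrite cE => h1 h2.
by rewrite mulr_ge0; lra.
Qed.

Let fallE k j : (j <= k)%N ->
  k.+1%:R * (k`!%:R / (k - j)`!%:R) = k.+1`!%:R / (k - j)`!%:R :> R.
Proof. by move=> jk; rewrite factS natrM mulrA. Qed.

Lemma pnorm_iterated_le k : (k <= d)%N ->
  pnorm p q (M k) <= 2 * \sum_(0 <= j < k.+1)
    c ^+ j * (k`!%:R / (k - j)`!%:R) * mean p (M (k - j)%N).
Proof.
have q0 : 0 < q by have := q_ge2; lra.
elim: k => [_|k IH kd].
  rewrite big_nat1 expr0 mul1r divff// mul1r.
  have cM S : M 0 S = M 0 finset.set0 by exact: M_0.
  rewrite (eq_mean p cM) mean_cst//.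
  have -> : pnorm p q (M 0) = M 0 finset.set0.
    rewrite -[RHS](pnorm_cst p q0 (M_ge0 _ _)); congr (_ `^ _).
    by apply: eq_mean => S; rewrite cM.
  by have := M_ge0 0 finset.set0; lra.
have [h _] := self_bounding_moment p01 q_ge2 (ler0n R k.+1)
   (M_ge0 k) (M_ge0 k.+1)
   (M_mono k.+1) (fun i S => M_diff i S kd) (fun S => M_sum S kd).
apply: le_trans h _.
rewrite big_nat_recl// expr0 mul1r subn0 divff; last first.
  by rewrite pnatr_eq0 -lt0n fact_gt0.
rewrite mul1r mulrDr lerD2l -cE.
apply: le_trans (ler_wpM2l _ (IH (ltnW kd))) _.
  by rewrite mulr_ge0.
rewrite mulrCA ler_wpM2l// mulr_sumr le_eqVlt; apply/orP; left; apply/eqP.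
apply: eq_big_nat => j /andP[_ jk].
by rewrite subSS -fallE// exprS; ring.
Qed.

Lemma sqrtr_sum_le (r : seq nat) (F : nat -> R) : (forall j, 0 <= F j) ->
  Num.sqrt (\sum_(j <- r) F j) <= \sum_(j <- r) Num.sqrt (F j).
Proof.
move=> F0; elim: r => [|j r IH]; first by rewrite !big_nil sqrtr0.
rewrite !big_cons; apply: le_trans (lerD (lexx _) IH).
set s := \sum_(j <- r) F j.
have s0 : 0 <= s by exact: sumr_ge0.
rewrite -(ler_pXn2r (ltn0Sn 1)) ?nnegrE ?addr_ge0 ?sqrtr_ge0//.
rewrite sqr_sqrtr ?addr_ge0// sqrrD !sqr_sqrtr// -addrA lerD2l lerDr.
by rewrite mulrn_wge0// mulr_ge0 ?sqrtr_ge0.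
Qed.

(** With C = c d ||M_(d-1)||_q the positive part is at most
    sqrt (C E M_d) + C, and C is at most 2 \sum_j T_j by the unfolded
    recursion; under the square root this 2 may be enlarged to 4 = 2^2. *)
Lemma iterated_positive_part : (0 < d)%N ->
  pnorm p q (fun S => Num.max (M d S - mean p (M d)) 0) <=
  2 * \sum_(1 <= j < d.+1)
    (c `^ (j%:R / 2) * Num.sqrt (d`!%:R / (d - j)`!%:R)
       * Num.sqrt (mean p (M d) * mean p (M (d - j)%N))
     + c ^+ j * (d`!%:R / (d - j)`!%:R) * mean p (M (d - j)%N)).
Proof.
move=> d0; have mM k : 0 <= mean p (M k) by exact: mean_ge0.
pose T j := c ^+ j * (d`!%:R / (d - j)`!%:R) * mean p (M (d - j)%N).
have T0 j : 0 <= T j by rewrite !mulr_ge0 ?exprn_ge0 ?invr_ge0.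
have dE : d = d.-1.+1 by rewrite prednK.
have dd : (d.-1 < d)%N by rewrite -dE.
have Md i S : M d S - M d (S :\ i) <= M d.-1 S.
  by have := M_diff i S dd; rewrite prednK.
have [_ h] := self_bounding_moment p01 q_ge2 (ler0n R d) (M_ge0 d.-1) (M_ge0 d)
   (M_mono d) Md (fun S => M_sum S (leqnn d)).
apply: le_trans h _; rewrite -cE; set C := c * _ * _.
have C0 : 0 <= C by rewrite !mulr_ge0 ?pnorm_ge0.
have CT : C <= 2 * \sum_(1 <= j < d.+1) T j.
  have cd0 : 0 <= c * d%:R by rewrite mulr_ge0.
  apply: le_trans (ler_wpM2l cd0 (pnorm_iterated_le (ltnW dd))) _.
  rewrite mulrCA ler_wpM2l// mulr_sumr big_add1/= [in leLHS]prednK//.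
  rewrite le_eqVlt; apply/orP; left; apply/eqP.
  apply: eq_big_nat => j /andP[_ jd].
  have jd1 : (j <= d.-1)%N by rewrite -ltnS prednK.
  have E : (d - j.+1)%N = (d.-1 - j)%N.
    by rewrite subnS -[in RHS]subn1 -subnDA add1n subnS.
  have := fallE jd1; rewrite prednK// => F.
  by rewrite /T E -F exprS; ring.
have sqrtT j : Num.sqrt (T j * mean p (M d)) =
    c `^ (j%:R / 2) * Num.sqrt (d`!%:R / (d - j)`!%:R) *
    Num.sqrt (mean p (M d) * mean p (M (d - j)%N)).
  have f0 : 0 <= d`!%:R / (d - j)`!%:R :> R by rewrite divr_ge0.
  rewrite /T -mulrA [mean _ _ * mean _ _]mulrC sqrtrM ?mulr_ge0 ?exprn_ge0//.
  rewrite sqrtrM ?exprn_ge0//; congr (_ * _ * _).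
  by rewrite -powR12_sqrt ?exprn_ge0// -powR_mulrn// -powRrM.
rewrite big_split/= mulrDr; apply: lerD => //.
apply: (@le_trans _ _ (Num.sqrt (
    \sum_(1 <= j < d.+1) 2 ^+ 2 * (T j * mean p (M d))))).
  rewrite ler_wsqrtr// -mulr_sumr -mulr_suml mulrA ler_wpM2r//.
  apply: le_trans CT _; rewrite ler_wpM2r ?sumr_ge0//.
  by rewrite -natrX ler_nat.
apply: le_trans (sqrtr_sum_le _ _) _.
  by move=> j; rewrite !mulr_ge0// exprn_ge0.
rewrite mulr_sumr; apply: ler_sum => j _.
by rewrite sqrtrM ?exprn_ge0// sqrtr_sqr ger0_norm// sqrtT.
Qed.


End iterated_bound.

(** * The chaos as a function of the support *)

Section chaos_on_sets.
Context {R : realType} {n d : nat}.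
Variable TT : set (chaos_coef R n d).
Hypothesis TT_nonempty : TT !=set0.
Hypothesis TT_compact : compact TT.
Hypothesis TT_ge0 : forall t, TT t -> forall I, 0 <= t I.
Implicit Types (S J : {set 'I_n}) (t : chaos_coef R n d) (k : nat).

Definition link_sum J S t : R :=
  \sum_(I : ksubset n d | (J \subset val I) && (val I :\: J \subset S)) t I.

(** With S the set of variables equal to 1 this is M_k; for k = d the only J is
    empty and it is Z. *)
Definition max_link k S : R :=
  \big[Num.max/0]_(J : ksubset n (d - k))
    sup [set link_sum (val J) S t | t in TT].

(** Compactness of TT makes each coordinate of t bounded. *)
Lemma link_sum_ubound J S : has_ubound [set link_sum J S t | t in TT].
Proof.
have H (I : ksubset n d) : exists b : R, forall t, TT t -> t I <= b.
  have cI : compact ((@proj (ksubset n d) (fun=> R) I) @` TT).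
    apply: continuous_compact => //; apply: continuous_subspaceT.
    exact: proj_continuous.
  have [_ [b ub]] := compact_has_sup (image_nonempty _ TT_nonempty) cI.
  by exists b => t Tt; apply: ub; exists t.
pose b I := sval (cid (H I)).
exists (\sum_(I : ksubset n d |
  (J \subset val I) && (val I :\: J \subset S)) b I).
move=> _ [t Tt <-]; apply: ler_sum => I _.
by rewrite /b; case: cid => x /= /(_ t Tt).
Qed.

Lemma link_sum_le_max k (J : ksubset n (d - k)) S t : TT t ->
  link_sum (val J) S t <= max_link k S.
Proof.
move=> Tt; rewrite /max_link.
apply: le_trans (le_bigmax _ (fun J : ksubset n (d - k) =>
  sup [set link_sum (val J) S t | t in TT]) J).
by apply: ub_le_sup; [exact: link_sum_ubound|exists t].
Qed.

Lemma max_link_le k S (x : R) : 0 <= x ->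
  (forall (J : ksubset n (d - k)) t, TT t -> link_sum (val J) S t <= x) ->
  max_link k S <= x.
Proof.
move=> x0 Hx; apply: bigmax_le => // J _; apply: ge_sup.
  exact: image_nonempty.
by move=> _ [t Tt <-]; exact: Hx.
Qed.

Lemma max_link_ge0 k S : 0 <= max_link k S.
Proof. exact: bigmax_ge_id. Qed.

Lemma link_sum_subset J S S' t : TT t -> S \subset S' ->
  link_sum J S t <= link_sum J S' t.
Proof.
move=> Tt SS; rewrite /link_sum [leLHS]big_mkcond [leRHS]big_mkcond.
apply: ler_sum => I _; case: ifP => [/andP[-> IS]|_].
  by rewrite (fintype.subset_trans IS SS).
by case: ifP => // _; exact: TT_ge0.
Qed.

Lemma max_link_mono k i S : max_link k (S :\ i) <= max_link k S.
Proof.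
apply: max_link_le => [|J t Tt]; first exact: max_link_ge0.
apply: le_trans (link_sum_le_max J S Tt).
by apply: link_sum_subset => //; exact: finset.subD1set.
Qed.

Lemma max_link0 S S' : max_link 0 S = max_link 0 S'.
Proof.
apply: eq_bigr => J _; congr sup; apply: eq_imagel => t Tt.
apply: eq_bigl => I; apply: andb_id2l => JI.
suff -> : val I :\: val J = finset.set0 by rewrite !finset.sub0set.
apply/eqP; rewrite finset.setD_eq0 (_ : val J = val I) //.
apply/eqP; rewrite finset.eqEcard JI /=.
by rewrite (eqP (valP I)) (eqP (valP J)) subn0.
Qed.

(** The monomials of the partial chaos at J that are lost when i is deleted
    contain i, hence are monomials of the partial chaos at J with i added. *)
Lemma max_link_diff k i S : (k < d)%N ->
  max_link k.+1 S - max_link k.+1 (S :\ i) <= max_link k S.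
Proof.
move=> kd; rewrite lerBlDl; apply: max_link_le => [|J t Tt].
  by rewrite addr_ge0 ?max_link_ge0.
apply: le_trans (lerD (link_sum_le_max J (S :\ i) Tt) (lexx _)).
rewrite {1}/link_sum.
rewrite (bigID (fun I : ksubset n d => i \notin val I :\: val J))/=.
apply: lerD.
  rewrite le_eqVlt; apply/orP; left; apply/eqP; apply: eq_bigl => I.
  by rewrite finset.subsetD1 andbA.
have [iJ|iJ] := boolP (i \in val J).
  rewrite big1 ?max_link_ge0// => I /andP[_].
  by rewrite !inE iJ.
have cJ : #|i |: val J| == (d - k)%N.
  rewrite finset.cardsU1 iJ (eqP (valP J)) add1n subnS prednK//.
  by rewrite subn_gt0.
apply: le_trans
  (link_sum_le_max (Sub (i |: val J) cJ : ksubset n (d - k)) S Tt).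
rewrite /link_sum /= [leLHS]big_mkcond [leRHS]big_mkcond; apply: ler_sum => I _.
case: ifP => [/andP[/andP[JI IS]]|_]; last first.
  by case: ifP => // _; exact: TT_ge0.
rewrite negbK inE => /andP[_ iI].
rewrite finset.subUset finset.sub1set iI JI /= ifT //.
by apply: fintype.subset_trans IS; apply: finset.setDS; exact: finset.subsetUr.
Qed.

(** A monomial of the partial chaos at J involves k variables, so it survives
    the deletion of exactly n - k coordinates. *)
Lemma sum_link_sum k (J : ksubset n (d - k)) S t : (k <= d)%N -> (d <= n)%N ->
  \sum_i link_sum (val J) (S :\ i) t = (n - k)%:R * link_sum (val J) S t.
Proof.
move=> kd dn; rewrite /link_sum mulr_sumr.
under eq_bigr do rewrite big_mkcond.
rewrite exchange_big /= [RHS]big_mkcond; apply: eq_bigr => I _.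
under eq_bigr do rewrite finset.subsetD1 andbA.
case: ifP => [JS|_]; last by rewrite big1.
rewrite -big_mkcond /= (eq_bigl (fun i => i \in ~: (val I :\: val J)));
  last first.
  by move=> i; rewrite finset.in_setC.
rewrite sumr_const -[LHS]mulr_natl; congr (_%:R * _).
have := finset.cardsC (val I :\: val J); rewrite card_ord.
have /andP[JI _] := JS.
rewrite finset.cardsDS// (eqP (valP I)) (eqP (valP J)) subKn// => e.
by rewrite -[X in _ = (X - k)%N]e addKn.
Qed.

Lemma max_link_sum k S : (k <= d)%N -> (d < n)%N ->
  \sum_i (max_link k S - max_link k (S :\ i)) <= k%:R * max_link k S.
Proof.
move=> kd dn; have kn := leq_ltn_trans kd dn.
rewrite sumrB sumr_const card_ord -[_ *+ n]mulr_natl lerBlDr addrC -lerBlDr.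
rewrite -mulrBl -natrB ?(ltnW kn)//.
have nk0 : 0 < (n - k)%:R :> R by rewrite ltr0n subn_gt0.
rewrite -ler_pdivlMl//; apply: max_link_le => [|J t Tt].
  rewrite mulr_ge0 ?invr_ge0 ?(ltW nk0)// sumr_ge0// => i _.
  exact: max_link_ge0.
rewrite ler_pdivlMl// -sum_link_sum ?(ltnW dn)//.
by apply: ler_sum => i _; exact: link_sum_le_max.
Qed.

End chaos_on_sets.

(** * Transfer to the probability space *)

Section law_of_the_support.
Context {disp : measure_display} {Omega : measurableType disp} {R : realType}.
Variables (P : probability Omega R) (n : nat) (X : 'I_n -> {RV P >-> R}).
Hypothesis X01 : forall i w, X i w = 0 \/ X i w = 1.
Hypothesis X_indep : mutually_independent X.
Implicit Types (S : {set 'I_n}) (w : Omega).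

Definition ones w : {set 'I_n} := [set i | X i w == 1]%SET.

Definition prob_one i : R := fine (P (X i @^-1` [set 1])).

Let mX1 i : measurable (X i @^-1` [set 1]).
Proof. by rewrite -[_ @^-1` _]setTI; apply: measurable_funP. Qed.

Lemma prob_one01 i : 0 <= prob_one i <= 1.
Proof.
rewrite /prob_one; apply/andP; split; first exact: fine_ge0.
by rewrite -lee_fin fineK ?fin_num_measure// probability_le1.
Qed.

Lemma preimage_onesE S : ones @^-1` [set S] =
  \bigcap_(i in [set` (finset.setT : {set 'I_n})])
     X i @^-1` (if i \in S then [set 1] else [set 0]).
Proof.
apply/seteqP; split => w /=.
  move=> wS i _ /=; rewrite -wS inE; case: eqP => //= X1.
  by have [] := X01 i w.
move=> H; apply/setP => i; rewrite inE.
have := H i; rewrite /= finset.in_setT => /(_ isT).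
case: (i \in S) => /= ->; first by rewrite eqxx.
by rewrite eq_sym oner_eq0.
Qed.

Lemma measurable_preimage_ones S : measurable (ones @^-1` [set S]).
Proof.
rewrite preimage_onesE; apply: fin_bigcap_measurable => [|i _].
  exact: finite_finset.
by case: ifP => _; rewrite -[_ @^-1` _]setTI; apply: measurable_funP.
Qed.

Lemma prob_ones S : P (ones @^-1` [set S]) = (weight prob_one S)%:E.
Proof.
rewrite preimage_onesE X_indep; last by move=> i; case: ifP.
rewrite /weight -prodEFin; apply: eq_big => [i|i _].
  by rewrite finset.in_setT.
have P1 : P (X i @^-1` [set 1]) = (prob_one i)%:E.
  by rewrite /prob_one fineK// fin_num_measure.
case: ifP => // _; rewrite EFinB -P1 -probability_setC//; congr (P _).
apply/seteqP; split => w /=.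
  by move=> ->; apply/eqP; rewrite eq_sym oner_eq0.
by have [] := X01 i w.
Qed.

Lemma integral_ones (F : {set 'I_n} -> R) : (forall S, 0 <= F S) ->
  (\int[P]_w (F (ones w))%:E = (mean prob_one F)%:E)%E.
Proof.
move=> F0.
transitivity (\int[P]_w
    (\sum_(S : {set 'I_n}) (F S)%:E * (\1_(ones @^-1` [set S]) w)%:E))%E.
  apply: eq_integral => w _; rewrite (bigD1 (ones w))//= big1 ?adde0.
    by rewrite indicE mem_set//= mule1.
  move=> S Sw; rewrite indicE memNset ?mule0//= => wS.
  by move: Sw; rewrite wS eqxx.
rewrite ge0_integral_sum//; last 2 first.
- move=> S; apply: measurable_funeM; apply/measurable_EFinP.
  exact/measurable_indic/measurable_preimage_ones.
- by move=> S w _; rewrite mule_ge0// lee_fin.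
rewrite /mean -sumEFin; apply: eq_bigr => S _.
have mS := measurable_preimage_ones S.
rewrite ge0_integralZl_EFin//; last first.
  exact/measurable_EFinP/measurable_indic.
rewrite integral_indic// setIT [weight _ _ * _]mulrC EFinM.
by congr (_ * _)%E; exact: prob_ones.
Qed.

Lemma fine_expectation_ones (F : {set 'I_n} -> R) : (forall S, 0 <= F S) ->
  fine ('E_P[F \o ones])%E = mean prob_one F.
Proof. by move=> F0; rewrite unlock integral_ones. Qed.

Lemma Lnorm_ones q (F : {set 'I_n} -> R) : (forall S, 0 <= F S) ->
  ('N[P]_q%:E[EFin \o (F \o ones)] = (pnorm prob_one q F)%:E)%E.
Proof.
move=> F0; rewrite unlock /pnorm -poweR_EFin -integral_ones; last first.
  by move=> S; exact: powR_ge0.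
congr poweR; apply: eq_integral => w _ /=.
by rewrite ger0_norm.
Qed.

Lemma prod_ones (A : {set 'I_n}) w :
  \prod_(i in A) X i w = (A \subset ones w)%:R.
Proof.
have [AS|] := boolP (A \subset ones w).
  rewrite big1// => i iA.
  by have := fintype.subsetP AS i iA; rewrite inE => /eqP.
move=> /subsetPn[i iA]; rewrite inE => /eqP Xi.
by rewrite (bigD1 i)//=; have [->|//] := X01 i w; rewrite mul0r.
Qed.

Context {d : nat}.
Variable TT : set (chaos_coef R n d).

Lemma chaos_max_ones k w : chaos_max X TT k w = max_link TT k (ones w).
Proof.
apply: eq_bigr => J _; congr sup; apply: eq_imagel => t _.
rewrite /link_sum big_mkcondr; apply: eq_bigr => I _.
by rewrite prod_ones; case: ifP; rewrite ?mul1r ?mul0r.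
Qed.

Hypothesis TT_nonempty : TT !=set0.
Hypothesis TT_compact : compact TT.
Hypothesis TT_ge0 : forall t, TT t -> forall I, 0 <= t I.

Lemma chaos_sup_ones w : chaos_sup X TT w = max_link TT d (ones w).
Proof.
transitivity (sup [set link_sum finset.set0 (ones w) t | t in TT]).
  congr sup; apply: eq_imagel => t _.
  rewrite /link_sum big_mkcondr.
  apply: eq_big => [I|I _]; first by rewrite finset.sub0set.
  by rewrite prod_ones finset.setD0; case: ifP; rewrite ?mul1r ?mul0r.
have c0 : #|(finset.set0 : {set 'I_n})| == (d - d)%N by rewrite cards0 subnn.
have J0 (J : ksubset n (d - d)) : val J = finset.set0.
  by apply/eqP; rewrite -cards_eq0 (eqP (valP J)) subnn.
apply/le_anti/andP; split.
  pose J : ksubset n (d - d) := Sub finset.set0 c0.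
  apply: le_trans (le_bigmax _ (fun J : ksubset n (d - d) =>
    sup [set link_sum (val J) (ones w) t | t in TT]) J).
  by rewrite J0.
apply: bigmax_le => [|J _]; last by rewrite J0.
have [t Tt] := TT_nonempty.
apply: (@le_trans _ _ (link_sum finset.set0 (ones w) t)).
  by apply: sumr_ge0 => I _; exact: TT_ge0.
by apply: ub_le_sup; [exact: link_sum_ubound|exists t].
Qed.

End law_of_the_support.

Theorem theorem15 (disp : measure_display) (Omega : measurableType disp)
    (R : realType) (P : probability Omega R) (n d : nat)
    (d_ge1 : (1 <= d)%N) (d_lt_n : (d < n)%N)
    (X : 'I_n -> {RV P >-> R})
    (X01 : forall i w, X i w = 0 \/ X i w = 1)
    (X_indep : mutually_independent X)
    (TT : set (chaos_coef R n d))
    (TT_nonempty : TT !=set0) (TT_compact : compact TT)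
    (TT_ge0 : forall t, TT t -> forall I, 0 <= t I)
    (q : R) (q_ge2 : 2 <= q) :
  let Z : Omega -> R := chaos_sup X TT in
  let M : nat -> Omega -> R := chaos_max X TT in
  let EZ : R := fine ('E_P[Z])%E in
  let EM (k : nat) : R := fine ('E_P[M k])%E in
  ('N[P]_q%:E[EFin \o (fun w => Num.max (Z w - EZ) 0)%R] <=
   (2 * \sum_(1 <= j < d.+1)
      ((kappa R * q) `^ (j%:R / 2)
         * Num.sqrt (d`!%:R / (d - j)`!%:R) * Num.sqrt (EZ * EM (d - j)%N)
       + (kappa R * q) ^+ j
         * (d`!%:R / (d - j)`!%:R) * EM (d - j)%N))%R%:E)%E.
Proof.
pose p := prob_one X.
have ZE : chaos_sup X TT = max_link TT d \o ones X.
  by apply/funext => w; exact: chaos_sup_ones.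
have EZE : fine ('E_P[chaos_sup X TT])%E = mean p (max_link TT d).
  by rewrite ZE fine_expectation_ones// => S; exact: max_link_ge0.
have EME k : fine ('E_P[chaos_max X TT k])%E = mean p (max_link TT k).
  rewrite (_ : chaos_max X TT k = max_link TT k \o ones X); last first.
    by apply/funext => w; exact: chaos_max_ones.
  by rewrite fine_expectation_ones// => S; exact: max_link_ge0.
have bound := @iterated_positive_part R _ p (prob_one01 X) d (max_link TT)
  (max_link_ge0 TT) (max_link_mono TT_nonempty TT_compact TT_ge0)
  (max_link0 TT)
  (fun k i S => @max_link_diff R n d TT TT_nonempty TT_compact TT_ge0 k i S)
  (fun k S kd => max_link_sum TT_nonempty TT_compact S kd d_lt_n)
  q q_ge2 _ erefl d_ge1.
lazy beta zeta; rewrite EZE ZE.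
under eq_bigr do rewrite EME.
apply: le_trans (_ : _ <= (pnorm p q (fun S =>
  Num.max (max_link TT d S - mean p (max_link TT d)) 0))%:E)%E _; last first.
  by rewrite lee_fin; exact: bound.
rewrite -(Lnorm_ones X01 X_indep) ?lexx// => S.
by rewrite le_max lexx orbT.
Qed.
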